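(* Let $m\ge 1$ and let $\alpha_1,\dots,\alpha_{m+1}\ge 1$ be integers. Let $X\sim\mathrm{Exp}(1)$. The number of directed Hamiltonian cycles in the complete multipartite graph $K_{\alpha_1,\alpha_2,\dots,\alpha_{m+1}}$ equals $$\mathbb E\left[\frac1X\prod_{i=1}^{m+1}(-1)^{\alpha_i}\alpha_i!\,L^{(-1)}_{\alpha_i}(X)\right].$$
   Context: $K_{\alpha_1,\dots,\alpha_{m+1}}$ is the complete $(m+1)$-partite graph with parts of sizes $\alpha_1,\dots,\alpha_{m+1}$. The number of directed Hamiltonian cycles in a graph $G$ with at least two vertices is the number of cyclic permutations $\sigma$ of $V(G)$ (a single cycle on all vertices) with $v$ and $\sigma(v)$ adjacent for every vertex $v$; in particular $K_n$ has $(n-1)!$ of them for $n\ge2$, and $K_2$ has one. $\mathrm{Exp}(1)$ is the exponential distribution with density $e^{-x}$ on $[0,\infty)$. The associated Laguerre polynomials are $L_n^{(-1)}(t)=\frac{(-1)^n}{n!}e^{-tD^2}[t^n]$, where $D=\frac{d}{dt}$ and $e^{-tD^2}=\sum_{k\ge0}\frac{(-1)^k}{k!}(tD^2)^k$ with $tD^2$ the operator $p(t)\mapsto t\,p''(t)$; explicitly, for $n\ge 1$, $(-1)^n n!\,L_n^{(-1)}(t)=\sum_{k=1}^n(-1)^{n-k}\frac{n!}{k!}\binom{n-1}{k-1}t^k$. *)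

(* Defs.v *)
From HB Require Import structures.
From mathcomp Require Import all_boot all_order all_algebra perm.
From mathcomp Require Import zify ring.
From mathcomp Require Import all_classical all_reals all_analysis.

Set Implicit Arguments.
Unset Strict Implicit.
Unset Printing Implicit Defensive.

Import Order.TTheory GRing.Theory Num.Theory.

Local Open Scope ring_scope.

(* The [i]-th part is the fibre of [tag] over [i]; it has [alpha i] elements. *)
Definition multipartite_vertex (n : nat) (alpha : 'I_n -> nat) : finType :=
  {i : 'I_n & 'I_(alpha i)}.

Definition complete_multipartite (n : nat) (alpha : 'I_n -> nat) :
    rel (multipartite_vertex alpha) :=
  fun u v => tag u != tag v.

(* Fixed points count as cycles in [porbits s], so [#|porbits s| == 1] says    *)
(* that [s] is a single cycle on all of [V].                                   *)
Definition directed_hamiltonian_cycles (V : finType) (e : rel V) :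
    {set {perm V}} :=
  [set s : {perm V} | (#|porbits s| == 1)%N && [forall v, e v (s v)]].

Section Laguerre.
Variable F : numFieldType.
Implicit Type p : {poly F}.

Definition tD2 p : {poly F} := 'X * p^`(2).

Lemma size_tD2 p : (size (tD2 p) <= (size p).-1)%N.
Proof.
rewrite /tD2 mulrC; have [->|nz] := eqVneq p^`(2) 0.
  by rewrite mul0r size_poly0.
rewrite size_mulX //.
have pn0 : p != 0 by apply: contraNneq nz => ->; rewrite linear0.
have dn0 : p^`() != 0.
  by apply: contraNneq nz => d0; rewrite derivnS derivn1 d0 linear0.
rewrite derivnS derivn1.
apply: leq_trans (lt_size_deriv dn0) _.
by rewrite -ltnS prednK ?lt_size_deriv // lt0n size_poly_eq0.
Qed.

Lemma iter_tD2_eq0 p k : (size p <= k)%N -> iter k tD2 p = 0.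
Proof.
move=> h; apply/eqP; rewrite -size_poly_leq0.
suff : (size (iter k tD2 p) <= size p - k)%N.
  by move/leq_trans; apply; rewrite leqn0 subn_eq0.
elim: {h} k => [|k IH] /=; first by rewrite subn0.
apply: leq_trans (size_tD2 _) _.
by rewrite subnS; case: (size _) (size p - k)%N IH => [|a] [|b].
Qed.

(* By [iter_tD2_eq0] the terms of the exponential series with [size p <= k]    *)
(* vanish, so the truncation loses nothing.                                    *)
Definition exp_NtD2 p : {poly F} :=
  \sum_(k < size p) ((-1) ^+ k / k`!%:R) *: iter k tD2 p.

Definition laguerreN1 (n : nat) : {poly F} :=
  ((-1) ^+ n / n`!%:R) *: exp_NtD2 'X^n.

Lemma iter_tD2Xn n k :
  iter k tD2 'X^n = (n ^_ k * n.-1 ^_ k)%:R *: 'X^(n - k) :> {poly F}.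
Proof.
elim: k => [|k IH]; first by rewrite !ffactn0 muln1 scale1r subn0.
rewrite iterS IH /tD2 derivnZ derivnXn -[X in _ *: X]scaler_nat.
have [lt|ge] := ltnP k n.-1; last first.
  rewrite (@ffact_small n.-1 k.+1) // (@ffact_small (n - k) 2); last by lia.
  by rewrite muln0 !scale0r scaler0 mulr0.
rewrite -!scalerAr -exprS scalerA -natrM.
have -> : (n - k - 2).+1 = (n - k.+1)%N by lia.
congr (_%:R *: _); rewrite !ffactnSr ffactn0 mul1n subn0.
have -> : (n - k - 1 = n.-1 - k)%N by lia.
by rewrite mulnACA.
Qed.

Lemma laguerreN1E n : (0 < n)%N ->
  ((-1) ^+ n * n`!%:R) *: laguerreN1 n =
  \sum_(1 <= k < n.+1)
    ((-1) ^+ (n - k) * (n`!%:R / k`!%:R) * 'C(n.-1, k.-1)%:R) *: 'X^k.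
Proof.
move=> n0; have fnz k : k`!%:R != 0 :> F by rewrite pnatr_eq0 -lt0n fact_gt0.
rewrite /laguerreN1 scalerA mulrACA -exprMn mulrNN mulr1 expr1n mul1r.
rewrite divff // scale1r /exp_NtD2 size_polyXn.
rewrite big_ord_recr /= iter_tD2Xn [X in (_ * X)%N]ffact_small; last by lia.
rewrite muln0 scale0r scaler0 addr0.
rewrite [RHS]big_nat_rev /= add1n big_add1 /= big_mkord.
apply: eq_bigr => -[k /= kn] _; rewrite iter_tD2Xn scalerA !subSS.
have -> : (n - (n - k) = k)%N by lia.
congr (_ *: _); have -> : ((n - k).-1 = n.-1 - k)%N by lia.
rewrite bin_sub; last by lia.
rewrite natrM -!mulrA; congr (_ * _).
rewrite -(bin_ffact n.-1) -(ffact_fact (ltnW kn)) !natrM.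
by field; rewrite !fnz.
Qed.
End Laguerre.

(* Main.v *)
(* Let E be the mean of polynomials in X, so that E p = p(0) + E p', and      *)
(* let A^a_n be the polynomials with exponential generating function          *)
(* exp (t u / (1 + u)) / (1 + u)^a, so that A^0_n = (-1)^n n! L_n^(-1) and    *)
(* A^0_n = t A^2_(n-1).  Cutting a Hamiltonian cycle at a vertex of part i0   *)
(* turns it into a walk that exhausts the other vertices and closes up.  More *)
(* generally, if b_i vertices of each part i remain to be visited from a      *)
(* vertex of part j, the number of ways to close up is                        *)
(*   W_j(b) = E (\prod_i A^([i = i0] + [i = j])_(b_i))                        *)
(* unless j = i0 and no vertex outside i0 remains.  Indeed both sides satisfy *)
(* W_j(b) = \sum_(k != j) b_k W_k(b - 1_k): apply E p = p(0) + E p' to        *)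
(* p = \prod_i A^[i = i0]_(b_i), using (A^a_n)' = n A^(a+1)_(n-1) and         *)
(* A^a_n = A^(a+1)_n + n A^(a+1)_(n-1).                                       *)
Require Import Defs.
From HB Require Import structures.
From mathcomp Require Import all_boot all_order all_algebra perm.
From mathcomp Require Import zify ring.
From mathcomp Require Import all_classical all_reals all_analysis.
From mathcomp Require Import measurable_realfun.

Set Implicit Arguments.
Unset Strict Implicit.
Unset Printing Implicit Defensive.

Import Order.TTheory GRing.Theory Num.Theory.
Import numFieldNormedType.Exports.

Local Open Scope ring_scope.

(** The count and the expectation meet in the functional [exp_mean], which sends ['X^k] to [k!], the
    [k]-th moment of Exp(1); [expectation_horner] identifies it with the mean of a polynomial in
    [X]. On the combinatorial side, [card_directed_hamiltonian_cycles] cuts each cycle at [v0], and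
    [size_closing_walks] evaluates the number of resulting walks by the recursion [walk_mean_rec].
    For a full cycle both ends lie in the part of [v0], of size n say, which contributes A^2_(n-1),
    while every other part contributes A^0. Since t A^2_(n-1) = A^0_n ([laguerre_mulX]), restoring
    the symmetric product costs the factor 1/X. *)

Section ExpMean.
Variable R : comNzRingType.
Implicit Types p q : {poly R}.

Definition exp_mean p : R := \sum_(i < size p) p`_i * i`!%:R.

Lemma exp_mean_widen n p : (size p <= n)%N ->
  exp_mean p = \sum_(i < n) p`_i * i`!%:R.
Proof.
move=> pn; rewrite /exp_mean (big_ord_widen n (fun i => p`_i * i`!%:R) pn).
rewrite big_mkcond; apply: eq_bigr => i _; case: ltnP => // pi.
by rewrite nth_default ?mul0r.
Qed.

Lemma exp_meanD p q : exp_mean (p + q) = exp_mean p + exp_mean q.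
Proof.
have m1 := leq_maxl (size p) (size q); have m2 := leq_maxr (size p) (size q).
rewrite (exp_mean_widen (size_polyD p q)) (exp_mean_widen m1).
rewrite (exp_mean_widen m2) -big_split; apply: eq_bigr => i _.
by rewrite coefD mulrDl.
Qed.

Lemma exp_mean0 : exp_mean 0 = 0.
Proof. by rewrite /exp_mean size_poly0 big_ord0. Qed.

Lemma exp_mean1 : exp_mean 1 = 1.
Proof. by rewrite /exp_mean size_poly1 big_ord1 coef1 mulr1. Qed.

Lemma exp_meanMn p n : exp_mean (p *+ n) = exp_mean p *+ n.
Proof.
by elim: n => [|n IH]; rewrite ?exp_mean0 // !mulrS exp_meanD IH.
Qed.

Lemma exp_mean_sum (I : Type) (r : seq I) (Q : pred I) (F : I -> {poly R}) :
  exp_mean (\sum_(i <- r | Q i) F i) = \sum_(i <- r | Q i) exp_mean (F i).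
Proof. by apply: (big_morph exp_mean exp_meanD exp_mean0). Qed.

(** Integration by parts against e^(-x), done on coefficients: (i+1)! p_(i+1) = i! (p')_i. *)
Lemma exp_mean_deriv p : exp_mean p = p.[0] + exp_mean p^`().
Proof.
rewrite (exp_mean_widen (leqnSn _)) big_ord_recl /= mulr1 horner_coef0.
congr (_ + _).
rewrite (exp_mean_widen (leq_trans (size_poly _ _) (leq_pred _))).
apply: eq_bigr => i _.
by rewrite coef_deriv factS natrM mulr_natl mulrnAr mulrnAl.
Qed.
End ExpMean.

Lemma deriv_prod (R : comNzRingType) (I : finType) (F : I -> {poly R}) :
  (\prod_i F i)^`() = \sum_j (F j)^`() * \prod_(i | i != j) F i.
Proof.
(* Uniqueness is carried along because [i != j] must remove exactly one factor. *)
elim: (index_enum I) (index_enum_uniq I) => [|x s IH] /=.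
  by rewrite !big_nil derivC.
case/andP=> xs us; rewrite !big_cons derivM IH // eqxx /=; congr (_ * _ + _).
  rewrite [RHS]big_seq_cond [LHS]big_seq; apply: eq_bigl => i.
  by case: eqVneq xs => [->|]; rewrite ?andbT // => /negPf->.
rewrite mulr_sumr 2!big_seq; apply: eq_bigr => j js.
rewrite big_cons; case: eqVneq xs js => [->/negPf->//|_ _ _].
by rewrite mulrCA.
Qed.

(** * Laguerre polynomials and the recursion for their mean products *)

Section Laguerre.
Variable R : numFieldType.

(* [laguerre a n] is [(-1)^n n! L_n^(a-1)], with exponential generating       *)
(* function [exp (t u / (1 + u)) / (1 + u)^a] in [u].                         *)
Definition laguerre (a n : nat) : {poly R} :=
  \poly_(k < n.+1)
    ((-1) ^+ (n - k) * (n`!%:R / k`!%:R) * 'C((n + a).-1, n - k)%:R).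

Let fact_neq0 k : k`!%:R != 0 :> R.
Proof. by rewrite pnatr_eq0 -lt0n fact_gt0. Qed.

Lemma laguerre0 a : laguerre a 0 = 1.
Proof.
apply/polyP => k; rewrite coef_poly coef1; case: k => [|k] //=.
by rewrite subnn bin0 expr0 divr1 !mulr1.
Qed.

(** Differentiating the generating function in t multiplies it by u / (1 + u). *)
Lemma laguerre_deriv a n : (laguerre a n)^`() = laguerre a.+1 n.-1 *+ n.
Proof.
case: n => [|n]; first by rewrite laguerre0 derivC mulr0n.
apply/polyP => k; rewrite coef_deriv coefMn !coef_poly ltnS.
case: ltnP => _; last by rewrite !mul0rn.
rewrite subSS /= addnS /= !factS !natrM.
rewrite -[in LHS]mulr_natr -[in RHS]mulr_natr.
by field; rewrite !fact_neq0 addrC natr1 pnatr_eq0.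
Qed.

(** Lowering [a] by one multiplies the generating function by 1 + u; on coefficients this is
    Pascal's rule. *)
Lemma laguerre_pascal a n :
  laguerre a n = laguerre a.+1 n + laguerre a.+1 n.-1 *+ n.
Proof.
case: n => [|n]; first by rewrite !laguerre0 addr0.
apply/polyP => k; rewrite coefD coefMn !coef_poly !addSn !addnS /=.
rewrite [(k < n.+2)%N]ltnS.
case: ltngtP => [kn|_|->]; last by rewrite subnn !bin0 mul0rn addr0.
  rewrite subSn // binS natrD exprS factS natrM -[in RHS]mulr_natr.
  by field; rewrite !fact_neq0.
by rewrite mul0rn addr0.
Qed.

Lemma laguerre_root0 n : (laguerre 0 n.+1).[0] = 0.
Proof. by rewrite horner_coef0 coef_poly /= subn0 addn0 bin_small ?mulr0. Qed.

(** Expanding the mean of [laguerre 0 n.+1] by [exp_mean_deriv] and by [laguerre_pascal] gives the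
    same term in [laguerre 1 n], which cancels. *)
Lemma exp_mean_laguerre1 n : exp_mean (laguerre 1 n.+1) = 0.
Proof.
have := exp_mean_deriv (laguerre 0 n.+1).
rewrite laguerre_root0 add0r laguerre_deriv {1}laguerre_pascal exp_meanD.
by move/(canRL (addrK _)); rewrite subrr.
Qed.

Lemma laguerreN1_laguerre n : (0 < n)%N ->
  ((-1) ^+ n * n`!%:R) *: laguerreN1 R n = laguerre 0 n.
Proof.
move=> n0; rewrite laguerreN1E // /laguerre poly_def big_ord_recl /=.
rewrite subn0 addn0 bin_small ?mulr0 ?scale0r ?add0r; last by lia.
rewrite big_add1 big_mkord; apply: eq_bigr => -[k /= kn] _; rewrite /bump add1n.
congr (_ *: _); congr (_ * _%:R).
by rewrite -bin_sub /=; [congr 'C(_, _); lia | lia].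
Qed.

Lemma laguerre_mulX n : (0 < n)%N -> laguerre 0 n = 'X * laguerre 2 n.-1.
Proof.
case: n => // n _; apply/polyP => -[|k]; rewrite coefXM !coef_poly /=.
  by rewrite subn0 addn0 bin_small ?mulr0.
rewrite ltnS; case: ltnP => // kn; rewrite subSS addn0 addn2 /=.
have <- : 'C(n, k) = 'C(n, n - k) by rewrite bin_sub.
have <- : 'C(n.+1, k.+1) = 'C(n.+1, n - k) by rewrite -bin_sub // subSS.
have := congr1 (fun i => i%:R : R) (mul_bin_diag n.+1 k).
rewrite !factS !natrM /= => E.
have Sk : k.+1%:R != 0 :> R by rewrite pnatr_eq0.
have -> : 'C(n.+1, k.+1)%:R = n.+1%:R * 'C(n, k)%:R / k.+1%:R :> R.
  by rewrite E mulrAC divff ?mul1r.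
by field; rewrite fact_neq0 nat1r Sk.
Qed.

Section Product.
Variables (I : finType) (i0 : I).

(** Each end of the walk, the closing vertex in part [i0] and the current one in part [j], raises
    the parameter of its part by one. *)
Definition walk_mean (j : I) (b : I -> nat) : R :=
  exp_mean (\prod_i laguerre ((i == i0) + (i == j)) (b i)).

Lemma walk_mean_rec j b : (exists2 i, i != i0 & (0 < b i)%N) ->
  walk_mean j b =
  \sum_(k | k != j) walk_mean k (fun i => (b i - (i == k))%N) *+ b k.
Proof.
move=> [l li0 bl].
pose q := \prod_i laguerre (i == i0) (b i).
(* When [b k = 0] the subtraction truncates, but the multiplicity [b k] kills the term. *)
pose G k := walk_mean k (fun i => (b i - (i == k))%N) *+ b k.
have qG : exp_mean q = \sum_k G k.
  rewrite exp_mean_deriv /q horner_prod (bigD1 l) //= (negPf li0).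
  rewrite -(prednK bl) laguerre_root0 mul0r add0r deriv_prod exp_mean_sum.
  apply: eq_bigr => k _; rewrite /G /walk_mean -exp_meanMn.
  rewrite [in RHS](bigD1 k) //= eqxx.
  rewrite laguerre_deriv addn1 subn1 mulrnAl; congr (exp_mean (_ * _ *+ _)).
  by apply: eq_bigr => i /negPf->; rewrite addn0 subn0.
(* Pascal's rule on factor [j] splits off [G j], which cancels the term [k = j] of [qG]. *)
have : walk_mean j b + G j = exp_mean q.
  rewrite /G /walk_mean /q -exp_meanMn -exp_meanD; congr exp_mean.
  rewrite (bigD1 j) //= eqxx addn1 [X in X *+ _](bigD1 j) //= eqxx addn1 subn1.
  rewrite [RHS](bigD1 j) //= [in RHS]laguerre_pascal mulrDl mulrnAl.
  congr (_ * _ + _ * _ *+ _); apply: eq_bigr => i /negPf->;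
    by rewrite addn0 ?subn0.
by rewrite qG (bigD1 j) //= addrC => H; apply: addIr H.
Qed.
End Product.
End Laguerre.

(** * Walks that exhaust a set of vertices and then step to [v0] *)

Section ClosingWalks.
Variables (V : finType) (e : rel V) (v0 : V).

(** [n] is fuel, meant to be [#|B|]. The walks are listed, not just counted, so that they can be
    matched with permutations. *)
Fixpoint closing_walks n u (B : {set V}) : seq (seq V) :=
  if n is n'.+1 then
    [seq w :: s | w <- enum [set w in B | e u w],
                  s <- closing_walks n' w (B :\ w)]
  else if e u v0 then [:: [::]] else [::].

Lemma mem_closing_walks n u (B : {set V}) s : #|B| = n ->
  (s \in closing_walks n u B) = perm_eq s (enum B) && path e u (rcons s v0).
Proof.
elim: n u B s => [|n IH] u B s cB /=.
  have -> : enum B = [::] by apply: size0nil; rewrite -cardE.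
  case: s => [|w s]; first by rewrite /= andbT; case: (e u v0).
  by case: perm_nilP => // _; case: (e u v0).
have sB w : w \in B -> #|B :\ w| = n.
  by move=> wB; move: cB; rewrite (cardsD1 w) wB => -[].
have pB w s' : w \in B ->
    perm_eq (w :: s') (enum B) = perm_eq s' (enum (B :\ w)).
  move=> wB; rewrite -(perm_cons w s'); apply: permPr.
  apply: uniq_perm; rewrite /= ?enum_uniq ?mem_enum ?setD11 //= => x.
  by rewrite inE !mem_enum in_setD1; case: eqVneq => // ->.
apply/allpairsPdep/andP => [[w [s' [+ + ->]]]|[]].
  rewrite mem_enum inE => /andP[wB uw]; rewrite IH ?sB // => /andP[ps ws].
  by rewrite pB //= uw.
case: s => [|w s] ps; first by have := perm_size ps; rewrite -cardE cB.
move=> /= /andP[uw ws].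
have wB : w \in B by rewrite -mem_enum -(perm_mem ps) mem_head.
exists w, s; split=> //; first by rewrite mem_enum inE wB.
by rewrite IH ?sB // -pB // ps.
Qed.

Lemma closing_walks_uniq n u B : uniq (closing_walks n u B).
Proof.
elim: n u B => [|n IH] u B /=; first by case: (e u v0).
apply: allpairs_uniq_dep => [|w _|]; [exact: enum_uniq|exact: IH|].
by move=> [w s] [w' s'] _ _ /= [-> ->].
Qed.

Lemma size_closing_walksS n u (B : {set V}) :
  size (closing_walks n.+1 u B) =
  (\sum_(w in B | e u w) size (closing_walks n w (B :\ w)))%N.
Proof.
rewrite size_allpairs_dep sumnE big_map big_enum.
by apply: eq_bigl => w; rewrite inE.
Qed.

End ClosingWalks.

(** * Hamiltonian cycles as closing walks *)

Section HamiltonianCycles.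
Variables (V : finType) (e : rel V) (v0 : V).
Local Notation tour s := (v0 :: s).

Let tour_of (s : {perm V}) := traject s (s v0) #|V|.-1.

Let cardV_gt0 : (0 < #|V|)%N. Proof. by apply/card_gt0P; exists v0. Qed.

Let porbit_full (s : {perm V}) :
  #|porbits s| = 1%N -> porbit s v0 = finset.setT.
Proof.
move/eqP/cards1P => [A sA]; apply/setP => x.
rewrite finset.in_setT -eq_porbit_mem.
have h y : porbit s y = A.
  by apply/set1P; rewrite -sA; apply: imset_f.
by rewrite !h eqxx.
Qed.

Let tour_ofP (s : {perm V}) : #|porbits s| = 1%N ->
  [/\ uniq (tour (tour_of s)), tour (tour_of s) =i predT
    & fcycle s (tour (tour_of s))].
Proof.
move=> s1; have sT := porbit_full s1.
have tE : tour (tour_of s) = traject s v0 #|porbit s v0|.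
  by rewrite sT cardsT /tour_of -[in RHS](prednK cardV_gt0).
split; rewrite ?tE ?uniq_traject_porbit //.
  by move=> x; rewrite -porbit_traject sT inE.
(* The closing [v0] becomes the [#|V|]-th iterate of [s], so the whole cycle is one trajectory. *)
rewrite -tE /= /tour_of -{3}(iter_porbit s v0) sT cardsT.
rewrite -[in iter _](prednK cardV_gt0).
by rewrite iterSr -trajectSr fpath_traject.
Qed.

(** [tour_of] is a bijection: a tour determines its permutation through [next], and for any closing
    walk [p] the map [next (tour p)] is a permutation with inverse [prev (tour p)]. *)
Lemma card_directed_hamiltonian_cycles :
  #|directed_hamiltonian_cycles e| =
  size (closing_walks e v0 #|V|.-1 v0 [set~ v0]).
Proof.
set D := directed_hamiltonian_cycles e.
have cV : #|[set~ v0]| = #|V|.-1 by rewrite cardsC1.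
rewrite cardE -(size_map tour_of); apply: perm_size; apply: uniq_perm.
- rewrite map_inj_in_uniq ?enum_uniq // => s t.
  rewrite !mem_enum !inE => /andP[/eqP/tour_ofP[us ms cs] _].
  move=> /andP[/eqP/tour_ofP[ut mt ct] _] fst; apply/permP => x.
  by rewrite -(nextE cs) ?ms // -(nextE ct) ?mt // fst.
- exact: closing_walks_uniq.
move=> p; rewrite mem_closing_walks //; apply/mapP/andP.
  case=> s; rewrite mem_enum inE.
  move=> /andP[/eqP/tour_ofP[us ms cs] /forallP es] ->.
  split.
    apply: uniq_perm; rewrite ?enum_uniq //; first by case/andP: us.
    move=> x; rewrite mem_enum in_setC1; case: (eqVneq x v0) => [->|xv].
      by case/andP: us => /negPf.
    by have := ms x; rewrite !inE (negPf xv).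
  by apply: sub_path cs => x y /eqP <-.
case=> pp pe.
have up : uniq (tour p).
  by rewrite /= (perm_mem pp) (perm_uniq pp) enum_uniq mem_enum setC11.
have mp : tour p =i predT.
  by move=> x; rewrite inE (perm_mem pp) mem_enum in_setC1; case: eqVneq.
have cardp : size p = #|V|.-1 by rewrite (perm_size pp) -cardE.
pose s : {perm V} := perm (can_inj (prev_next up)).
have cs : fcycle s (tour p).
  rewrite (eq_fcycle (f' := next (tour p))) ?cycle_next // => x.
  by rewrite permE.
have pt : p = tour_of s.
  by have := fcycle_consE cs; rewrite cardp /= => -[].
exists s => //; rewrite mem_enum inE; apply/andP; split; last first.
  by apply/forallP => x; rewrite permE; apply: next_cycle => //; rewrite mp.
have v0T : porbit s v0 = finset.setT.
  apply/setP => y; rewrite inE; have : y \in tour p by rewrite mp.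
  by rewrite (fcycle_consE cs) => /trajectP[i _ ->]; rewrite -permX mem_porbit.
have oT x : porbit s x = finset.setT.
  by apply/eqP; rewrite -v0T eq_porbit_mem v0T inE.
apply/cards1P; exists finset.setT; apply/setP => O; rewrite inE.
by apply/imsetP/eqP => [[x _ ->]|->]; [exact: oT|exists v0; rewrite ?oT].
Qed.
End HamiltonianCycles.

(** * Closing walks when adjacency means different colours *)

Section ColoredWalks.
Variables (R : numFieldType) (V I : finType) (c : V -> I) (v0 : V).
Local Notation e := (fun u v => c u != c v).
Local Notation content B := (fun i => #|[set w in (B : {set V}) | c w == i]|).

Lemma size_closing_walks_monochromatic n u (B : {set V}) :
  #|B| = n -> c u = c v0 -> (forall w, w \in B -> c w = c v0) ->
  size (closing_walks e v0 n u B) = 0%N.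
Proof.
case: n => [|n] cB cu cw; first by rewrite /= cu eqxx.
rewrite size_closing_walksS big1 // => w /andP[wB].
by rewrite cu (cw w wB) eqxx.
Qed.

Lemma content_setD1 (B : {set V}) w i : w \in B ->
  content (B :\ w) i = (content B i - (i == c w))%N.
Proof.
move=> wB; case: eqVneq => [->|iw].
  rewrite [in RHS](cardsD1 w) inE wB eqxx add1n subn1 /=.
  by apply: eq_card => x; rewrite !inE andbA.
rewrite subn0; apply: eq_card => x; rewrite !inE.
by case: (eqVneq x w) => [->|] //=; rewrite [c w == i]eq_sym (negPf iw) andbF.
Qed.

(** The excluded case, [u] and all of [B] coloured like [v0], is a true exception: no walk exists,
    but [walk_mean] is the mean of A^2_n, namely (-1)^n n!. *)
Lemma size_closing_walks n u (B : {set V}) : #|B| = n ->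
    (c u != c v0) || [exists w in B, c w != c v0] ->
  (size (closing_walks e v0 n u B))%:R = walk_mean R (c v0) (c u) (content B).
Proof.
elim: n u B => [|n IH] u B cB.
  have B0 : B = finset.set0 by apply/eqP; rewrite -cards_eq0 cB.
  case/orP => [cu|/existsP[w]]; last by rewrite B0 inE.
  rewrite /= cu /walk_mean big1 ?exp_mean1 // => i _.
  rewrite (_ : #|_| = 0%N) ?laguerre0 // B0.
  by apply: eq_card0 => x; rewrite !inE.
have sB w : w \in B -> #|B :\ w| = n.
  by move=> wB; move: cB; rewrite (cardsD1 w) wB => -[].
rewrite size_closing_walksS natr_sum.
have [/exists_inP[w0 w0B cw0] _|] := boolP [exists w in B, c w != c v0].
  rewrite walk_mean_rec; last first.
    by exists (c w0) => //; apply/card_gt0P; exists w0; rewrite inE w0B eqxx.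
  rewrite (partition_big c (fun i => i != c u)) /=; last first.
    by move=> w /andP[_]; rewrite eq_sym.
  (* All next vertices of colour [i] contribute the same term, whence the multiplicity. *)
  apply: eq_bigr => i iu; rewrite -sumr_const; apply: eq_big => [w|w].
    rewrite !inE -andbA; congr (_ && _).
    case: (eqVneq (c w) i) => [->|]; rewrite ?andbF //.
    by rewrite eq_sym iu.
  case/andP=> /andP[wB uw] /eqP cw; rewrite IH ?sB //.
    rewrite cw /walk_mean; congr exp_mean; apply: eq_bigr => k _.
    by rewrite content_setD1 // cw.
  (* If [w] is coloured like [v0], it is not [w0], so [w0] remains to be visited and the induction
     hypothesis applies. *)
  case: eqVneq => //= cwv; apply/exists_inP; exists w0 => //.
  by rewrite !inE w0B andbT; apply: contraNneq cw0 => ->; rewrite cwv.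
move=> /exists_inPn Bm; rewrite orbF => cu.
have {}Bm w : w \in B -> c w = c v0 by move/Bm; rewrite negbK => /eqP.
rewrite big1 => [|w /andP[wB _]]; last first.
  rewrite size_closing_walks_monochromatic ?sB ?Bm // => x.
  by rewrite inE => /andP[_ /Bm].
have nB i : content B i = if i == c v0 then n.+1 else 0%N.
  case: eqVneq => [->|iv].
    rewrite -cB; apply: eq_card => x; rewrite inE.
    by case: (boolP (x \in B)) => // /Bm->; rewrite eqxx.
  apply: eq_card0 => x; rewrite !inE; apply/andP => -[/Bm-> /eqP vi].
  by rewrite vi eqxx in iv.
(* Only colour [c v0] remains, with parameter 1: the mean is 0, like the count. *)
rewrite /walk_mean (bigD1 (c v0)) //= big1 => [|i /negPf iv].
  by rewrite nB eqxx mulr1 [c v0 == c u]eq_sym (negPf cu) exp_mean_laguerre1.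
by rewrite nB iv laguerre0.
Qed.
End ColoredWalks.

Lemma card_part (n : nat) (alpha : 'I_n -> nat) i :
  #|[set w : multipartite_vertex alpha | tag w == i]| = alpha i.
Proof.
have injT := @eq_from_Tagged _ (fun i => 'I_(alpha i)) i.
rewrite -[RHS]card_ord -cardsT -(card_imset _ injT).
apply: eq_card => w; rewrite inE; apply/eqP/imsetP => [|[x _ ->]] //.
by case: w => k x /= ki; case: _ / ki; exists x.
Qed.

(** * Moments of the exponential distribution *)

Lemma ge0_integral_density d (T : measurableType d) (R : realType)
    (nu : {finite_measure set T -> \bar R})
    (mu : {sigma_finite_measure set T -> \bar R}) (g f : T -> \bar R) :
    mu.-integrable [set: T]%classic g ->
    (forall A, measurable A -> nu A = \int[mu]_(x in A) g x)%E ->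
    (forall x, 0 <= f x)%E -> measurable_fun [set: T]%classic f ->
  (\int[nu]_x f x = \int[mu]_x (f x * g x))%E.
Proof.
move=> ig nug f0 mf.
have numu : (nu `<< mu)%classic.
  apply/null_content_dominatesP => A mA muA0.
  by rewrite nug //; apply: null_set_integral => //;
  apply: measurable_funTS; exact: measurable_int ig.
rewrite -(Radon_Nikodym_SigmaFinite.change_of_variables numu) //.
have iN := Radon_Nikodym_SigmaFinite.f_integrable numu.
apply: ae_eq_integral => //.
- by apply: emeasurable_funM => //; exact: measurable_int iN.
- by apply: emeasurable_funM => //; exact: measurable_int ig.
(* The Radon-Nikodym derivative and [g] have equal integrals over all measurable sets, hence agree
   almost everywhere. *)
apply: ae_eqe_mul2l; apply: integral_ae_eq => //.
  exact: measurable_int ig.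
by move=> A _ mA; rewrite -Radon_Nikodym_SigmaFinite.f_integral // nug.
Qed.

(** From e^x >= x^(n+1) / (n+1)!, the function is at most (n+1)! / x for x > 0. *)
Lemma cvgr_Xn_expRN (R : realType) n :
  (x ^+ n * expR (- x) @[x --> +oo] --> (0 : R))%classic.
Proof.
apply/cvgrPdist_le => e e0; near=> x.
have x0 : 0 < x by near: x; apply: nbhs_pinfty_gt; rewrite num_real.
rewrite sub0r normrN ger0_norm ?mulr_ge0 ?expR_ge0 ?exprn_ge0 ?(ltW x0) //.
rewrite expRN ler_pdivrMr ?expR_gt0 //.
have fx : n.+1`!%:R / e <= x.
  by near: x; apply: nbhs_pinfty_ge; rewrite num_real.
have : e * (x ^+ n.+1 / n.+1`!%:R) <= e * expR x.
  rewrite ler_pM2l //; apply: le_trans (expR_ge1Dxn n (ltW x0)).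
  by rewrite lerDr.
apply: le_trans.
rewrite mulrA ler_pdivlMr ?ltr0n ?fact_gt0 // exprS mulrA mulrC.
rewrite ler_wpM2r ?exprn_ge0 ?(ltW x0) //.
by rewrite mulrC -ler_pdivrMr.
Unshelve. all: by end_near. Qed.

Lemma cvgr_horner_expRN (R : realType) (p : {poly R}) :
  (p.[x] * expR (- x) @[x --> +oo] --> (0 : R))%classic.
Proof.
under eq_fun do rewrite horner_coef mulr_suml.
elim: (size p) => [|n IH].
  by under eq_fun do rewrite big_ord0; exact: cvg_cst.
under eq_fun do rewrite big_ord_recr /= -mulrA.
have := cvgD IH (cvgMr (a := p`_n) (@cvgr_Xn_expRN R n)).
by rewrite mulr0 addr0; apply.
Qed.

(** -q(x) e^(-x) is an antiderivative that tends to 0 at infinity. *)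
Lemma integral_horner_expRN (R : realType) (q : {poly R}) :
    (forall x, 0 <= x -> 0 <= (q - q^`()).[x]) ->
  (\int[lebesgue_measure]_(x in `[0%R, +oo[)
     ((q - q^`()).[x] * expR (- x))%:E)%E = q.[0]%:E.
Proof.
move=> q0.
have cE : continuous (fun x : R => expR (- x)).
  move=> x.
  by apply: continuous_comp; [exact: opp_continuous|exact: continuous_expR].
have cf (p : {poly R}) : continuous (fun x => p.[x] * expR (- x)).
  by move=> x; apply: continuousM; [exact: continuous_horner|exact: cE].
pose F x := - (q.[x] * expR (- x)).
have dF (x : R) : is_derive x 1 F ((q - q^`()).[x] * expR (- x)).
  apply: trigger_derive; rewrite !hornerE /GRing.scale /=; ring.
rewrite (@ge0_continuous_FTC2y _ _ F _ 0) //.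
- by rewrite /F oppr0 expR0 mulr1 sub0e EFinN oppeK.
- by move=> x x0; rewrite mulr_ge0 ?expR_ge0 // q0.
- exact: continuous_subspaceT.
- by rewrite -oppr0; apply: cvgN; exact: cvgr_horner_expRN.
- by apply: cvg_at_right_filter; apply: cvgN; exact: cf.
- by move=> x _; rewrite derive1E; apply: derive_val.
Qed.

(** The witness is the sum of (n! / k!) x^k over k <= n, built by q_(n+1) = x^(n+1) + (n+1) q_n. *)
Lemma sub_deriv_Xn (R : comNzRingType) n :
  exists2 q : {poly R}, q - q^`() = 'X^n & q.[0] = n`!%:R.
Proof.
elim: n => [|n [q qE q0]]; first by exists 1; rewrite ?derivC ?subr0 ?hornerE.
exists ('X^(n.+1) + q *+ n.+1).
  rewrite derivD derivXn derivMn opprD addrACA -mulrnBl qE /=.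
  by rewrite -addrA addNr addr0.
by rewrite !hornerE hornerMn q0 expr0n /= add0r factS mulnC natrM mulr_natr.
Qed.

Lemma integral_Xn_exponential_pdf (R : realType) n :
  (\int[lebesgue_measure]_x ((`|x| ^+ n)%:E * (exponential_pdf 1 x)%:E))%E
  = (n`!%:R : R)%:E.
Proof.
have [q qE q0] := sub_deriv_Xn R n.
rewrite -q0 -integral_horner_expRN; last first.
  by move=> x x0; rewrite qE hornerXn exprn_ge0.
rewrite [RHS]integral_mkcond; apply: eq_integral => x _.
rewrite /exponential_pdf !patchE; case: ifPn => [|_]; last by rewrite mule0.
rewrite inE /= in_itv /= andbT => x0.
by rewrite qE hornerXn ger0_norm // mul1r mulN1r.
Qed.

Section ExponentialMoments.
Context (R : realType) (d : measure_display) (T : measurableType d).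
Context (P : probability T R) (X : {RV P >-> R}).
Hypothesis X_exp1 : forall A : set R, measurable A ->
  distribution P X A = exponential_prob 1 A.

(** Absolute values keep the integrand nonnegative for the change of measure; the result then yields
    the integrability needed for signed moments. *)
Lemma integral_norm_Xn n :
  (\int[P]_w (`|X w| ^+ n)%:E)%E = (n`!%:R : R)%:E.
Proof.
have mX : measurable_fun setT (X : T -> measurableTypeR R).
  exact: measurable_funPT X.
pose Y : {RV P >-> measurableTypeR R} :=
  HB.pack (X : T -> measurableTypeR R) (isMeasurableFun.Build _ _ _ _ _ mX).
have mf : measurable_fun setT (fun x : measurableTypeR R => (`|x| ^+ n)%:E).
  by apply/measurable_EFinP; apply: measurable_funX; exact: normr_measurable.
rewrite -integral_Xn_exponential_pdf.
transitivity (\int[distribution P Y]_x (`|x| ^+ n)%:E)%E.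
  by rewrite ge0_integral_distribution // => y; rewrite lee_fin exprn_ge0.
apply: ge0_integral_density => //.
exact: integrable_exponential_pdf.
Qed.

Lemma exponential_ae_ge0 : {ae P, forall w, 0 <= X w}.
Proof.
have m0 : measurable (`]-oo, 0[%classic : set R) by [].
exists (X @^-1` `]-oo, 0[)%classic; split.
- by rewrite -[X in measurable X]setTI; apply: measurable_funP.
- have := X_exp1 m0; rewrite /distribution /pushforward => ->.
  rewrite /exponential_prob integral0_eq // => x; rewrite /= in_itv /= => x0.
  by rewrite lt0_exponential_pdf.
- by move=> w /= /negP; rewrite -ltNge in_itv.
Qed.

Lemma integrable_Xn n : P.-integrable setT (fun w => (X w ^+ n)%:E).
Proof.
apply/integrableP; split.
  by apply/measurable_EFinP; apply: measurable_funX.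
under eq_integral do rewrite abse_EFin normrX.
by rewrite integral_norm_Xn ltry.
Qed.

Lemma integral_Xn n : (\int[P]_w (X w ^+ n)%:E)%E = (n`!%:R : R)%:E.
Proof.
rewrite -integral_norm_Xn; apply: ae_eq_integral => //.
- exact: measurable_int (integrable_Xn n).
- apply/measurable_EFinP; apply: measurable_funX.
  by apply: measurableT_comp.
- by apply: filterS exponential_ae_ge0 => w X0 _; rewrite ger0_norm.
Qed.


Lemma expectation_horner (p : {poly R}) :
  'E_P[fun w => p.[X w]]%E = (exp_mean p)%:E.
Proof.
rewrite unlock; under eq_integral do rewrite horner_coef -sumEFin.
rewrite integral_sum //=; last first.
  move=> i; under eq_fun do rewrite EFinM.
  by apply: integrableZl => //; exact: integrable_Xn.
rewrite /exp_mean -sumEFin; apply: eq_bigr => i _.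
under eq_integral do rewrite EFinM.
by rewrite integralZl ?integral_Xn //; exact: integrable_Xn.
Qed.
End ExponentialMoments.

Theorem theorem6p5 (R : realType) (d : measure_display) (T : measurableType d)
    (P : probability T R) (X : {RV P >-> R})
    (X_exp1 : forall A : set R, measurable A ->
       distribution P X A = exponential_prob 1 A)
    (m : nat) (m_ge1 : (1 <= m)%N)
    (alpha : 'I_m.+1 -> nat) (alpha_ge1 : forall i, (1 <= alpha i)%N) :
  ((#|directed_hamiltonian_cycles (@complete_multipartite m.+1 alpha)|)%:R)%:E
  = 'E_P[fun w : T => ((X w)^-1 *
       \prod_(i < m.+1)
         ((-1) ^+ alpha i * (alpha i)`!%:R * (laguerreN1 R (alpha i)).[X w]))%R]%E.
Proof.
(* Cycles are cut at [v0]; [v1], in another part since m >= 1, rules out the exceptional case of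
   [size_closing_walks]. *)
pose first_of i : multipartite_vertex alpha :=
  Tagged (fun i => 'I_(alpha i)) (Ordinal (alpha_ge1 i)).
pose v0 := first_of ord0; pose v1 := first_of ord_max.
have v10 : ord_max != ord0 :> 'I_m.+1 by rewrite -val_eqE /= -lt0n.
rewrite (card_directed_hamiltonian_cycles _ v0) size_closing_walks; first last.
- apply/orP; right; apply/exists_inP; exists v1 => //.
  by rewrite !inE; apply: contraNneq v10 => /(congr1 tag) /= ->.
- by rewrite cardsC1.
pose Q : {poly R} := \prod_(i < m.+1)
  laguerre R ((i == ord0) + (i == ord0)) (alpha i - (i == ord0)).
have -> : walk_mean R (tag v0) (tag v0)
    (fun i => #|[set w in [set~ v0] | tag w == i]|) = exp_mean Q.
  rewrite /walk_mean; congr exp_mean; apply: eq_bigr => i _; congr laguerre.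
  rewrite -finset.setTD content_setD1 ?finset.in_setT //; congr (_ - _)%N.
  by rewrite -[RHS]card_part; apply: eq_card => w; rewrite !inE.
rewrite -(expectation_horner X_exp1); congr expectation; apply/funext => w.
rewrite (eq_bigr (fun i => (laguerre R 0 (alpha i)).[X w])); last first.
  by move=> i _; rewrite -hornerZ laguerreN1_laguerre.
rewrite /Q horner_prod (bigD1 ord0) //= [in RHS](bigD1 ord0) //= subn1 addn1.
rewrite (laguerre_mulX _ (alpha_ge1 ord0)) hornerM hornerX -mulrA.
rewrite [in LHS](eq_bigr (fun i => (laguerre R 0 (alpha i)).[X w])); last first.
  by move=> i /negPf->; rewrite subn0.
(* Where [X w = 0] the convention [0^-1 = 0] makes the right side 0; the left side vanishes too,
   through the factor A^0 of the last part. *)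
have [X0|X0] := eqVneq (X w) 0; last by rewrite mulKf.
rewrite X0 invr0 mul0r (bigD1 ord_max) //= -[alpha ord_max]prednK //.
by rewrite laguerre_root0 mul0r mulr0.
Qed.
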